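(* Let $\mathfrak K\subset\mathbb N$ be a subsequence. Suppose that $X$ is a Polish space and that (i) $(X,\mathcal B,m,T)$ is an invertible measure preserving transformation which is weakly rationally ergodic along $\mathfrak K$; (ii) there exist a set $\Omega\in R_{\mathfrak K}(T)_+$, open in $X$, and a countable base $\mathcal C$ for the topology of $\Omega$ such that (a) for every finite collection $\{C_i\}_{i=1}^k\subset\mathcal C$ there is a finite collection $\{D_j\}_{j=1}^\ell\subset\mathcal C$ with $m(D_i\cap D_j)=0$ for all $i\ne j$ and $\bigcup_{i=1}^kC_i=\bigcup_{j=1}^\ell D_j$ modulo $m$-null sets; (b) for all $A,B\in\mathcal C$, $$\frac1{a_n(\Omega)}\sum_{k=0}^{n-1}\bigl|m(A\cap T^{-k}B)-m(A)m(B)u_k(\Omega)\bigr|\to0\quad\text{as } n\to\infty,\ n\in\mathfrak K.$$ Then $(X,\mathcal B,m,T)$ is rationally weakly mixing along $\mathfrak K$.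
   Context: $(X,\mathcal B,m,T)$ denotes a conservative measure preserving transformation $T$ of a standard $\sigma$-finite measure space ($X$ Polish, $\mathcal B$ its Borel sets, $m$ non-atomic) with $m(X)=\infty$; conservative means $m(A\setminus\bigcup_{n\ge1}T^{-n}A)=0$ for all $A\in\mathcal B$. Write $\mathcal F:=\{A\in\mathcal B: m(A)<\infty\}$, $\mathcal C_+:=\{A\in\mathcal C: m(A)>0\}$ for $\mathcal C\subset\mathcal B$, and $\mathcal B\cap F:=\{A\in\mathcal B:A\subset F\}$. A subsequence $\mathfrak K\subset\mathbb N$ is an infinite subset. For $F\in\mathcal F_+$: $u_n(F):=\frac{m(F\cap T^{-n}F)}{m(F)^2}$ and $a_n(F):=\sum_{k=0}^{n-1}u_k(F)$. A conservative, ergodic $T$ is rationally weakly mixing along $\mathfrak K$ if there is $F\in\mathcal F_+$ such that for all $A,B\in\mathcal B\cap F$, $\frac1{a_n(F)}\sum_{k=0}^{n-1}|m(A\cap T^{-k}B)-m(A)m(B)u_k(F)|\to0$ as $n\to\infty$, $n\in\mathfrak K$. A conservative, ergodic $T$ is weakly rationally ergodic along $\mathfrak K$ if there is $F\in\mathcal F_+$ such that $\frac1{a_n(F)}\sum_{k=0}^{n-1}m(B\cap T^{-k}C)\to m(B)m(C)$ as $n\to\infty$, $n\in\mathfrak K$, for all $B,C\in\mathcal B\cap F$. $R_{\mathfrak K}(T)$ denotes the collection of all $F\in\mathcal F$ with this property (null sets being included by convention). *)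

(* Defs.v *)
From HB Require Import structures.
From mathcomp Require Import all_boot all_order all_algebra.
From mathcomp Require Import all_classical all_reals all_analysis.

Set Implicit Arguments.
Unset Strict Implicit.
Unset Printing Implicit Defensive.

Import Order.TTheory GRing.Theory Num.Theory.
Import numFieldNormedType.Exports.

Local Open Scope classical_set_scope.
Local Open Scope ring_scope.

Section topology.
Context {R : realType} {X : topologicalType}.

Definition is_metric (d : X -> X -> R) :=
  [/\ forall x, d x x = 0,
      forall x y, d x y = 0 -> x = y,
      forall x y, d x y = d y x &
      forall x y z, d x z <= d x y + d y z].

Definition induces_topology (d : X -> X -> R) :=
  forall (x : X) (A : set X),
    nbhs x A <-> exists2 e : R, 0 < e & [set y | d x y < e] `<=` A.

Definition complete_metric (d : X -> X -> R) :=
  forall u : nat -> X,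
    (forall e : R, 0 < e -> exists N : nat,
       forall i j, (N <= i)%N -> (N <= j)%N -> d (u i) (u j) < e) ->
    exists x : X, u @ \oo --> x.

Definition separable_space := exists2 S : set X, countable S & dense S.

Definition relatively_open (Om U : set X) :=
  exists2 V : set X, open V & U = V `&` Om.

Definition base_of_subspace (Om : set X) (C : set (set X)) :=
  (forall U, C U -> relatively_open Om U) /\
  (forall U, relatively_open Om U ->
     exists2 D : set (set X), D `<=` C & U = \bigcup_(V in D) V).

End topology.

Definition polish (R : realType) (X : topologicalType) :=
  separable_space (X := X) /\
  exists d : X -> X -> R,
    [/\ is_metric d, induces_topology d & complete_metric d].

Notation borel X := (g_sigma_algebraType (@open X)).

Section dynamics.
Context {d : measure_display} {X : measurableType d} {R : realType}.
Variables (m : {measure set X -> \bar R}) (T : X -> X).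

Definition atom (A : set X) :=
  [/\ measurable A, (0 < m A)%E &
      forall B, measurable B -> B `<=` A -> m B = 0%E \/ m (A `\` B) = 0%E].

Definition nonatomic := forall A : set X, ~ atom A.

Definition eq_mod_null (A B : set X) := m (A `+` B) = 0%E.

Definition measure_preserving :=
  measurable_fun setT T /\
  forall A, measurable A -> m (T @^-1` A) = m A.

Definition invertible :=
  exists S : X -> X, [/\ measurable_fun setT S, cancel T S & cancel S T].

(* T^{-k} A *)
Definition preiter (k : nat) (A : set X) : set X := iter k T @^-1` A.

Definition conservative :=
  forall A, measurable A ->
    m (A `\` \bigcup_(n in [set n | (1 <= n)%N]) preiter n A) = 0%E.

Definition ergodic :=
  forall A, measurable A -> T @^-1` A = A -> m A = 0%E \/ m (~` A) = 0%E.

Definition finite_measurable : set (set X) :=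
  [set A | measurable A /\ (m A < +oo)%E].

(* C_+ *)
Definition positive_part (C : set (set X)) : set (set X) :=
  [set A | C A /\ (0 < m A)%E].

(* The junk value of fine at +oo is never met below: the sets measured are
   contained in a set of finite measure. *)
Definition mr (A : set X) : R := fine (m A).

Definition u_ (F : set X) (n : nat) : R :=
  mr (F `&` preiter n F) / mr F ^+ 2.

Definition a_ (F : set X) (n : nat) : R := \sum_(0 <= k < n) u_ F k.

Definition mixing_average (F A B : set X) (n : nat) : R :=
  (a_ F n)^-1 *
  \sum_(0 <= k < n) `|mr (A `&` preiter k B) - mr A * mr B * u_ F k|.

Definition ergodic_average (F B C : set X) (n : nat) : R :=
  (a_ F n)^-1 * \sum_(0 <= k < n) mr (B `&` preiter k C).

Definition rationally_weakly_mixing (K : set nat) :=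
  [/\ conservative, ergodic &
      exists2 F, positive_part finite_measurable F &
        forall A B, measurable A -> A `<=` F -> measurable B -> B `<=` F ->
          mixing_average F A B n @[n --> within K \oo] --> (0 : R)].

Definition weakly_rationally_ergodic_set (K : set nat) (F : set X) :=
  forall B C, measurable B -> B `<=` F -> measurable C -> C `<=` F ->
    ergodic_average F B C n @[n --> within K \oo] --> (mr B * mr C : R).

Definition weakly_rationally_ergodic (K : set nat) :=
  [/\ conservative, ergodic &
      exists2 F, positive_part finite_measurable F &
        weakly_rationally_ergodic_set K F].

(* R_K(T); null sets belong to it by convention *)
Definition R_ (K : set nat) : set (set X) :=
  [set F | finite_measurable F /\
           (m F = 0%E \/ weakly_rationally_ergodic_set K F)].

End dynamics.

(* Main.v *)
Require Import Defs.
From HB Require Import structures.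
From mathcomp Require Import all_boot all_order all_algebra.
From mathcomp Require Import all_classical all_reals all_analysis.
From mathcomp Require Import ring lra.

(** One takes [F := Omega]. Replacing [A], [B] by [U], [V] in the mixing average
changes it by at most the ergodic averages of [(A `+` U, Omega)] and
[(Omega, B `+` V)] plus a term controlled by the measures of the two symmetric
differences; weak rational ergodicity of [Omega] bounds the limit of these
ergodic averages by the same measures. So it suffices to treat a class of sets
dense in measure. Almost disjoint finite unions of elements of [C] form such a
class: the mixing average is subadditive over them, by (a) they represent all
finite unions of elements of [C] up to null sets, and the sets approximable by
finite unions form a sigma-algebra containing the open sets, because in a
metric space the complement of an open set is a decreasing intersection of open
sets. *)

Set Implicit Arguments.
Unset Strict Implicit.
Unset Printing Implicit Defensive.

Import Order.TTheory GRing.Theory Num.Theory.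
Import numFieldNormedType.Exports.

Local Open Scope classical_set_scope.
Local Open Scope ring_scope.

(** * Symmetric differences and convergence to zero *)

Lemma preimage_setY (aT rT : Type) (f : aT -> rT) (A B : set rT) :
  f @^-1` (A `+` B) = f @^-1` A `+` f @^-1` B.
Proof. by rewrite !setY_def. Qed.

Lemma setY_sub (aT : Type) (A B F : set aT) :
  A `<=` F -> B `<=` F -> A `+` B `<=` F.
Proof. by move=> AF BF x; rewrite setY_def => -[[/AF]|[/BF]]. Qed.

Lemma measurable_setY (d : measure_display) (X : ringOfSetsType d)
  (A B : set X) : measurable A -> measurable B -> measurable (A `+` B).
Proof.
by move=> mA mB; rewrite setY_def; apply: measurableU; exact: measurableD.
Qed.

Lemma near_lt_cvg0 (R : realType) (I : Type) (G : set_system I)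
  {FG : Filter G} (f : I -> R) :
  (forall i, 0 <= f i) ->
  (forall e, 0 < e -> \forall i \near G, f i < e) -> f i @[i --> G] --> (0 : R).
Proof.
move=> f0 fe; apply/cvgr0Pnorm_lt => e e0.
by apply: filterS (fe e e0) => i; rewrite ger0_norm.
Qed.

(** * Approximation in measure by a class of sets *)

Section approximation.
Context {d : measure_display} {X : measurableType d} {R : realType}.
Implicit Types (nu : {measure set X -> \bar R}) (P : set (set X)).

(** Closure of [P] in the pseudometric given by the measure of the symmetric difference. *)
Definition approximable nu P (A : set X) :=
  forall e : R, 0 < e -> exists2 U, P U & (nu (A `+` U) < e%:E)%E.

Lemma measure_setY_trans nu (A B D : set X) :
  measurable A -> measurable B -> measurable D ->
  (nu (A `+` D) <= nu (A `+` B) + nu (B `+` D))%E.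
Proof.
move=> mA mB mD.
apply: (@le_trans _ _ (nu ((A `+` B) `|` (B `+` D)))).
  apply: le_measure; rewrite ?inE.
  - exact: measurable_setY.
  - by apply: measurableU; exact: measurable_setY.
  - move=> x; rewrite !setY_def => -[[Ax nDx]|[Dx nAx]];
      have [Bx|nBx] := pselect (B x); rewrite /setU /setD /=; tauto.
by apply: measureU2; exact: measurable_setY.
Qed.

(** Closures are closed: half of [e] is spent on each approximation. Since [B] may depend on [e],
    limits of approximable sets are covered. *)
Lemma approximable_trans nu P (A : set X) : P `<=` measurable ->
  measurable A ->
  (forall e : R, 0 < e -> exists B, [/\ measurable B, approximable nu P B &
    (nu (A `+` B) < e%:E)%E]) ->
  approximable nu P A.
Proof.
move=> Pm mA H e e0; have e20 : 0 < e / 2 by rewrite divr_gt0.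
have [B [mB /(_ _ e20)[U PU BU] AB]] := H _ e20.
exists U => //; apply: (le_lt_trans (measure_setY_trans nu mA mB (Pm _ PU))).
by rewrite [e in e%:E]splitr EFinD; exact: lteD.
Qed.

Lemma approximableU nu P (A B : set X) : P `<=` measurable ->
  (forall U V, P U -> P V -> P (U `|` V)) ->
  measurable A -> measurable B ->
  approximable nu P A -> approximable nu P B -> approximable nu P (A `|` B).
Proof.
move=> Pm PU mA mB aA aB e e0; have e20 : 0 < e / 2 by rewrite divr_gt0.
have [[U PUU AU] [V PV BV]] := (aA _ e20, aB _ e20).
exists (U `|` V); first exact: PU.
have mAU := measurable_setY mA (Pm _ PUU).
have mBV := measurable_setY mB (Pm _ PV).
apply: (@le_lt_trans _ _ (nu ((A `+` U) `|` (B `+` V)))).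
  apply: le_measure; rewrite ?inE.
  - by apply: measurable_setY; apply: measurableU => //; exact: Pm.
  - exact: measurableU.
  - move=> x; rewrite !setY_def => -[[[Ax|Bx] H]|[[Ux|Vx] H]];
      move: H; rewrite /setU /setD /=; tauto.
apply: le_lt_trans (measureU2 nu mAU mBV) _.
by rewrite [e in e%:E]splitr EFinD; exact: lteD.
Qed.

(** Continuity from above, available because [nu] is finite. It reduces countable unions and
    intersections to a finite stage, up to an error below [e]. *)
Lemma vanishing_measure_lt nu (F : nat -> set X) (e : R) :
  (nu setT < +oo)%E -> (forall i, measurable (F i)) ->
  {homo F : n m / (n <= m)%N >-> (m <= n)%O} -> \bigcap_n F n = set0 ->
  0 < e -> exists n, (nu (F n) < e%:E)%E.
Proof.
move=> finnu mF ndF F0 e0.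
have F0oo : (nu (F 0%N) < +oo)%E.
  by apply: le_lt_trans finnu; apply: le_measure; rewrite ?inE.
have mcap : measurable (\bigcap_n F n) by rewrite F0.
have := nonincreasing_cvg_mu F0oo mF mcap ndF.
rewrite F0 measure0 => /fine_cvgP[fF /cvgr0Pnorm_lt/(_ e e0) Fe].
have [n _ /(_ _ (leqnn n))[fFn Fn]] := filterI fF Fe.
exists n; rewrite -[nu (F n)](fineK fFn) lte_fin.
by apply: le_lt_trans Fn; exact: ler_norm.
Qed.

Lemma approximable_bigcup nu P (A : nat -> set X) : (nu setT < +oo)%E ->
  P `<=` measurable -> P set0 -> (forall U V, P U -> P V -> P (U `|` V)) ->
  (forall n, measurable (A n)) -> (forall n, approximable nu P (A n)) ->
  approximable nu P (\bigcup_n A n).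
Proof.
move=> finnu Pm P0 PU mA aA.
pose B n := \big[setU/set0]_(i < n) A i.
have mB n : measurable (B n) by exact: bigsetU_measurable.
have mUA : measurable (\bigcup_n A n) by exact: bigcup_measurable.
apply: approximable_trans => // e e0.
have [n ne] : exists n, (nu (\bigcup_n A n `\` B n) < e%:E)%E.
  apply: vanishing_measure_lt => //.
  - by move=> i; exact: measurableD.
  - move=> n m nm; apply/subsetPset; apply: setDS.
    by apply: subset_bigsetU.
  - rewrite -subset0 => x H; have [[i _ Aix] _] := H 0%N I.
    (* [B n] unites the [A i] with [i < n], so [i.+1] is the first index whose partial union
       contains [A i]. *)
    by have [_] := H i.+1 I; apply; apply: (bigsetU_sup (ltnSn i)).
exists (B n); split => //.
  rewrite /B; elim: n {ne} => [|n ih].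
    rewrite big_ord0 => e' e'0; exists set0 => //.
    by rewrite setYK measure0 lte_fin.
  by rewrite big_ord_recr; apply: approximableU => //; exact: mB.
suff -> : \bigcup_n A n `+` B n = \bigcup_n A n `\` B n by [].
rewrite setY_def (_ : B n `\` _ = set0) ?setU0// setD_eq0.
exact: bigsetU_bigcup.
Qed.

(** The sequence decreases, so a single [A n] with [n] large is already close to the
    intersection. *)
Lemma approximable_bigcap nu P (A : nat -> set X) : (nu setT < +oo)%E ->
  P `<=` measurable -> (forall n, measurable (A n)) ->
  {homo A : n m / (n <= m)%N >-> (m <= n)%O} ->
  (forall n, approximable nu P (A n)) ->
  approximable nu P (\bigcap_n A n).
Proof.
move=> finnu Pm mA niA aA.
have mcap : measurable (\bigcap_n A n) by exact: bigcap_measurable.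
apply: approximable_trans => // e e0.
have [n ne] : exists n, (nu (A n `\` \bigcap_n A n) < e%:E)%E.
  apply: vanishing_measure_lt => //.
  - by move=> i; exact: measurableD.
  - move=> n m nm; apply/subsetPset; apply: setSD; apply/subsetPset.
    exact: niA.
  - rewrite -subset0 => x H; have [_ +] := H 0%N I.
    by apply => i _; have [] := H i I.
exists (A n); split => //.
suff -> : \bigcap_n A n `+` A n = A n `\` \bigcap_n A n by [].
rewrite setY_def (_ : _ `\` A n = set0) ?set0U// setD_eq0.
exact: bigcap_inf.
Qed.

(** Complementing both sets leaves their symmetric difference unchanged, so only complements of
    members of [P] have to be approximated. *)
Lemma approximableC nu P (A : set X) : P `<=` measurable ->
  (forall U, P U -> approximable nu P (~` U)) ->
  measurable A -> approximable nu P A -> approximable nu P (~` A).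
Proof.
move=> Pm PC mA aA; apply: approximable_trans => //.
  exact: measurableC.
move=> e e0; have [U PU AU] := aA _ e0.
exists (~` U); split; [exact/measurableC/Pm|exact: PC|].
suff -> : ~` A `+` ~` U = A `+` U by [].
rewrite !setY_def; apply/seteqP; split=> x; rewrite /setD/setU/setC/=;
  have [Ax|] := pselect (A x); have [Ux|] := pselect (U x); tauto.
Qed.

Lemma sigma_algebra_approximable nu P : (nu setT < +oo)%E ->
  P `<=` measurable -> P set0 -> (forall U V, P U -> P V -> P (U `|` V)) ->
  (forall U, P U -> approximable nu P (~` U)) ->
  sigma_algebra setT [set A | measurable A /\ approximable nu P A].
Proof.
move=> finnu Pm P0 PU PC; split.
- by split=> // e e0; exists set0 => //; rewrite setYK measure0 lte_fin.
- move=> A [mA aA]; rewrite setTD; split; first exact: measurableC.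
  exact: approximableC.
- move=> A H; split; first by apply: bigcup_measurable => n _; have [] := H n.
  by apply: approximable_bigcup => // n; have [] := H n.
Qed.

End approximation.

(** * Real-valued measure on sets of finite measure, and iterated preimages *)

Section mixing.
Context {d : measure_display} {X : measurableType d} {R : realType}.
Implicit Types (m : {measure set X -> \bar R}) (T : X -> X).
Implicit Types (A B D F U V : set X).

Lemma mr_ge0 m A : 0 <= mr m A.
Proof. by apply: fine_ge0; exact: measure_ge0. Qed.

Lemma finite_measurable_sub m A B : finite_measurable m B -> measurable A ->
  A `<=` B -> finite_measurable m A.
Proof.
move=> [mB fB] mA AB; split=> //; apply: le_lt_trans fB.
by apply: le_measure; rewrite ?inE.
Qed.

Lemma finite_measurableU m A B : finite_measurable m A ->
  finite_measurable m B -> finite_measurable m (A `|` B).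
Proof.
move=> [mA fA] [mB fB]; split; first exact: measurableU.
by apply: le_lt_trans (measureU2 m mA mB) _; exact: lte_add_pinfty.
Qed.

Lemma finite_measurable_fin_num m A :
  finite_measurable m A -> m A \is a fin_num.
Proof. by move=> [_ fA]; rewrite ge0_fin_numE. Qed.

Lemma le_mr m A B : finite_measurable m B -> measurable A -> A `<=` B ->
  mr m A <= mr m B.
Proof.
move=> fB mA AB; have fA := finite_measurable_sub fB mA AB.
apply: fine_le; rewrite ?finite_measurable_fin_num//.
by apply: le_measure; rewrite ?inE//; case: fB.
Qed.

Lemma mrU m A B : finite_measurable m A -> finite_measurable m B ->
  mr m (A `|` B) + mr m (A `&` B) = mr m A + mr m B.
Proof.
move=> fA fB; have [[mA A_oo] [mB B_oo]] := (fA, fB).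
have fAB : finite_measurable m (A `&` B).
  by apply: finite_measurable_sub fA _ _; [exact: measurableI|exact: subIsetl].
rewrite {1}/mr measureUfinl// fineB; last 2 first.
- by rewrite fin_numD !finite_measurable_fin_num.
- exact: finite_measurable_fin_num.
by rewrite subrK fineD// finite_measurable_fin_num.
Qed.

Lemma mrU_null m F A B : finite_measurable m F ->
  measurable A -> A `<=` F -> measurable B -> B `<=` F ->
  m (A `&` B) = 0%E -> mr m (A `|` B) = mr m A + mr m B.
Proof.
move=> fF mA AF mB BF AB0; rewrite -mrU; first by rewrite /mr AB0 addr0.
- exact: finite_measurable_sub fF _ _.
- exact: finite_measurable_sub fF _ _.
Qed.

Lemma mr_dist_le m A B : finite_measurable m A -> finite_measurable m B ->
  `|mr m A - mr m B| <= mr m (A `+` B).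
Proof.
move=> fA fB; have mY : finite_measurable m (A `+` B).
  apply: (finite_measurable_sub (finite_measurableU fA fB)).
    by apply: measurable_setY; [case: fA|case: fB].
  by rewrite setYE; exact: subDsetl.
have H D D' : finite_measurable m D -> finite_measurable m D' ->
    D `<=` D' `|` (A `+` B) -> mr m D <= mr m D' + mr m (A `+` B).
  move=> fD fD' sD; rewrite -mrU//.
  rewrite (@le_trans _ _ (mr m (D' `|` (A `+` B))))// ?lerDl ?mr_ge0//.
  by apply: le_mr sD; [exact: finite_measurableU|case: fD].
have AB : mr m A <= mr m B + mr m (A `+` B).
  apply: H => // x Ax; rewrite setY_def /setU /setD /=.
  by have [|] := pselect (B x); tauto.
have BA : mr m B <= mr m A + mr m (A `+` B).
  apply: H => // x Bx; rewrite setY_def /setU /setD /=.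
  by have [|] := pselect (A x); tauto.
by rewrite ler_norml; apply/andP; split; lra.
Qed.

Lemma preiterS T k A : preiter T k.+1 A = T @^-1` preiter T k A.
Proof.
by apply/seteqP; split=> x; rewrite /preiter /preimage /= -iterS iterSr.
Qed.

Lemma measurable_preiter m T k A : measure_preserving m T ->
  measurable A -> measurable (preiter T k A).
Proof.
move=> [mT _] mA; elim: k => [|k ih]; first exact: mA.
by rewrite preiterS -[T @^-1` _]setTI; exact: mT.
Qed.

Lemma measure_preiter m T k A : measure_preserving m T ->
  measurable A -> m (preiter T k A) = m A.
Proof.
move=> mpT mA; elim: k => [//|k <-].
by rewrite preiterS mpT.2//; exact: (measurable_preiter _ mpT).
Qed.

(** * Perturbation of the mixing average *)

Lemma a_ge0 m T F n : 0 <= a_ m T F n.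
Proof.
apply: sumr_ge0 => k _; apply: divr_ge0; first exact: mr_ge0.
by rewrite exprn_ge0// mr_ge0.
Qed.

Lemma mixing_average_ge0 m T F A B n : 0 <= mixing_average m T F A B n.
Proof.
rewrite mulr_ge0 ?invr_ge0 ?a_ge0//.
by apply: sumr_ge0 => k _.
Qed.

(** A termwise triangle inequality. The change of the intersection gives the two ergodic averages;
    the change of the product of measures carries the factor [u_ m T F k], whose sum [a_ m T F n] is
    cancelled by the normalisation. *)
Lemma mixing_average_le m T F A B U V n :
  measure_preserving m T -> finite_measurable m F ->
  measurable A -> A `<=` F -> measurable B -> B `<=` F ->
  measurable U -> U `<=` F -> measurable V -> V `<=` F ->
  mixing_average m T F A B n <= mixing_average m T F U V n +
    (ergodic_average m T F (A `+` U) F n + ergodic_average m T F F (B `+` V) n)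
    + (mr m (A `+` U) * mr m F + mr m F * mr m (B `+` V)).
Proof.
move=> mpT fF mA AF mB BF mU UF mV VF.
have fin D : measurable D -> D `<=` F -> finite_measurable m D.
  exact: finite_measurable_sub.
have mAU := measurable_setY mA mU; have mBV := measurable_setY mB mV.
have AUF := setY_sub AF UF; have BVF := setY_sub BF VF.
set c := (X in _ <= _ + X).
have c0 : 0 <= c by rewrite addr_ge0// mulr_ge0// mr_ge0.
(* The constant [c] is replaced by the average of [c * u_ m T F k], so that the comparison can be
   made term by term. *)
apply: (@le_trans _ _ (mixing_average m T F U V n +
    (ergodic_average m T F (A `+` U) F n + ergodic_average m T F F (B `+` V) n)
    + (a_ m T F n)^-1 * \sum_(0 <= k < n) (c * u_ m T F k))); last first.
  rewrite lerD2l -mulr_sumr -/(a_ m T F n) mulrCA.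
  (* If the normalising sum vanishes, as for [n = 0], its inverse is [0] by convention and the claim
     is [0 <= c]. *)
  have [->|a0] := eqVneq (a_ m T F n) 0; first by rewrite !mulr0.
  by rewrite mulVf// mulr1.
rewrite /mixing_average /ergodic_average -!mulrDr -!big_split /=.
apply: ler_wpM2l; first by rewrite invr_ge0 a_ge0.
apply: ler_sum => k _.
have u0 : 0 <= u_ m T F k.
  by apply: divr_ge0; [exact: mr_ge0|rewrite exprn_ge0// mr_ge0].
have mF : measurable F by case: fF.
have mpre D : measurable D -> measurable (preiter T k D).
  exact: (measurable_preiter _ mpT).
have finI D E : measurable D -> D `<=` F -> measurable E ->
    finite_measurable m (D `&` preiter T k E).
  move=> mD DF mE; apply: fin; first by apply: measurableI => //; exact: mpre.
  by move=> x [/DF].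
have H1 : `|mr m (A `&` preiter T k B) - mr m (U `&` preiter T k V)| <=
    mr m ((A `+` U) `&` preiter T k F) + mr m (F `&` preiter T k (B `+` V)).
  apply: (le_trans (mr_dist_le (finI _ _ mA AF mB) (finI _ _ mU UF mV))).
  rewrite -mrU; [|exact: finI|exact: finI].
  rewrite (@le_trans _ _ (mr m (((A `+` U) `&` preiter T k F) `|`
    (F `&` preiter T k (B `+` V)))))// ?lerDl ?mr_ge0//.
  apply: le_mr.
  - by apply: finite_measurableU; exact: finI.
  - by apply: measurable_setY; apply: measurableI => //; exact: mpre.
  (* If the two intersections disagree at [x], then [A] and [U] disagree at [x] or [B] and [V]
     disagree at the [k]-th iterate; the other coordinate stays in [F]. *)
  - move=> x; rewrite /preiter preimage_setY !setY_def.
    rewrite /setU /setD /setI /preimage /=.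
    have := AF x; have := UF x; have := BF (iter k T x); have := VF (iter k T x).
    have [|] := pselect (A x); have [|] := pselect (U x); tauto.
have H2 : `|mr m A * mr m B - mr m U * mr m V| <= c.
  have -> : mr m A * mr m B - mr m U * mr m V =
    (mr m A - mr m U) * mr m B + mr m U * (mr m B - mr m V) by ring.
  apply: (le_trans (ler_normD _ _)); rewrite !normrM.
  rewrite (ger0_norm (mr_ge0 m B)) (ger0_norm (mr_ge0 m U)).
  apply: lerD; apply: ler_pM => //; rewrite ?mr_ge0//.
  - by apply: mr_dist_le; exact: fin.
  - exact: le_mr.
  - exact: le_mr.
  - by apply: mr_dist_le; exact: fin.
set p := mr m _ in H1 *; set q := mr m _ in H1 *.
move: H1; set p1 := mr m _; set q1 := mr m _ => H1.
set s := u_ _ _ _ _ in u0 *; set ab := mr m A * mr m B in H2 *.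
set uv := mr m U * mr m V in H2 *.
have -> : p - ab * s = (q - uv * s) + (p - q) - (ab - uv) * s by ring.
apply: (le_trans (ler_normB _ _)); apply: lerD.
  by apply: (le_trans (ler_normD _ _)); rewrite lerD2l.
by rewrite normrM (ger0_norm u0) ler_wpM2r.
Qed.

(** * Subadditivity of the mixing average over almost disjoint unions *)

Lemma mixing_average_setUl m T F A A' B n :
  measure_preserving m T -> finite_measurable m F ->
  measurable A -> A `<=` F -> measurable A' -> A' `<=` F -> measurable B ->
  m (A `&` A') = 0%E ->
  mixing_average m T F (A `|` A') B n <=
    mixing_average m T F A B n + mixing_average m T F A' B n.
Proof.
move=> mpT fF mA AF mA' AF' mB AA'0.
rewrite /mixing_average -mulrDr -big_split /=.
apply: ler_wpM2l; first by rewrite invr_ge0 a_ge0.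
(* The expression inside the absolute value is additive in the first set, because both measures
   involved are additive over sets with null intersection. *)
apply: ler_sum => k _; apply: le_trans (ler_normD _ _).
have mpB := measurable_preiter k mpT mB.
rewrite setIUl (mrU_null fF mA AF mA' AF')// (mrU_null fF)//.
  by rewrite le_eqVlt; apply/orP; left; apply/eqP; congr `|_|; ring.
- exact: measurableI.
- by move=> x [/AF].
- exact: measurableI.
- by move=> x [/AF'].
- apply: subset_measure0 AA'0; [|exact: measurableI|by move=> x [[? _] []]].
  by apply: measurableI; exact: measurableI.
Qed.

(** As for the first argument, except that the null intersection now has to be pulled back by the
    iterate, which is where invariance of [m] enters. *)
Lemma mixing_average_setUr m T F A B B' n :
  measure_preserving m T -> finite_measurable m F ->
  measurable A -> A `<=` F -> measurable B -> B `<=` F ->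
  measurable B' -> B' `<=` F -> m (B `&` B') = 0%E ->
  mixing_average m T F A (B `|` B') n <=
    mixing_average m T F A B n + mixing_average m T F A B' n.
Proof.
move=> mpT fF mA AF mB BF mB' BF' BB'0.
rewrite /mixing_average -mulrDr -big_split /=.
apply: ler_wpM2l; first by rewrite invr_ge0 a_ge0.
apply: ler_sum => k _; apply: le_trans (ler_normD _ _).
have mpB := measurable_preiter k mpT mB.
have mpB' := measurable_preiter k mpT mB'.
rewrite /preiter preimage_setU setIUr
  (mrU_null fF mB BF mB' BF')// (mrU_null fF)//.
  by rewrite le_eqVlt; apply/orP; left; apply/eqP; congr `|_|; ring.
- exact: measurableI.
- by move=> x [/AF].
- exact: measurableI.
- by move=> x [/AF].
- have mBB' : measurable (B `&` B') by exact: measurableI.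
  apply: (@subset_measure0 _ _ _ m _ (preiter T k (B `&` B'))).
  + by apply: measurableI; exact: measurableI.
  + exact: (measurable_preiter _ mpT).
  + by move=> x [[_ ?] [_ ?]].
  + exact: etrans (measure_preiter k mpT mBB') BB'0.
Qed.

(** Induction principle for properties preserved only by almost disjoint unions. *)
Lemma ae_disjoint_bigcup_ind m (P : set X -> Prop) l (D : 'I_l -> set X) :
  P set0 ->
  (forall A B, P A -> P B -> m (A `&` B) = 0%E -> P (A `|` B)) ->
  (forall j, measurable (D j)) ->
  (forall j, P (D j)) -> (forall i j, i != j -> m (D i `&` D j) = 0%E) ->
  P (\bigcup_j D j).
Proof.
move=> P0 PU mD PD D0.
(* Without repetitions in [s], a newly added index differs from all earlier ones, so [D0] applies to
   each pair. *)
suff H (s : seq 'I_l) : uniq s -> P (\bigcup_(j in [set` s]) D j).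
  have -> : [set: 'I_l] = [set` enum 'I_l].
    by apply/seteqP; split=> i //= _; rewrite mem_enum.
  exact: H (enum_uniq _).
elim: s => [_|a s ih /= /andP[aNs us]].
  by rewrite (_ : [set` _] = set0) ?bigcup_set0//; apply/seteqP; split.
rewrite bigcup_seq big_cons; rewrite bigcup_seq in ih.
apply: PU => //; first exact: ih.
rewrite -bigcup_seq setI_bigcupr bigcup_seq big_seq.
(* A finite union of null sets is null; measurability is carried along because additivity of the
   measure requires it at each stage. *)
suff [] : measurable (\big[setU/set0]_(i <- s | i \in s) (D a `&` D i)) /\
    m (\big[setU/set0]_(i <- s | i \in s) (D a `&` D i)) = 0%E by [].
apply: (@big_ind _ (fun E => measurable E /\ m E = 0%E)
   set0 setU) => [|E E' [mE E0] [mE' E'0]|i si].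
- by rewrite measure0.
- by split; [exact: measurableU|rewrite measureU0].
- split; first exact: measurableI.
  by apply: D0; apply: contraNneq aNs => ->.
Qed.

Lemma mixing_average_set0l m T F B n : mixing_average m T F set0 B n = 0.
Proof.
rewrite /mixing_average big1 ?mulr0// => k _.
by rewrite set0I /mr measure0 !mul0r subrr normr0.
Qed.

Lemma mixing_average_set0r m T F A n : mixing_average m T F A set0 n = 0.
Proof.
rewrite /mixing_average big1 ?mulr0// => k _.
by rewrite /preiter preimage_set0 setI0 /mr measure0 mulr0 mul0r subrr normr0.
Qed.

Lemma cvg0_mixing_average_le m T K F A B (f : nat -> R) :
  (forall n, mixing_average m T F A B n <= f n) ->
  f n @[n --> within K \oo] --> (0 : R) ->
  mixing_average m T F A B n @[n --> within K \oo] --> (0 : R).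
Proof.
move=> Hf f0; apply: (squeeze_cvgr _ (cvg_cst 0) f0).
by near=> n; rewrite mixing_average_ge0 Hf.
Unshelve. all: by end_near. Qed.

(** Two successive inductions: the [E j] are united against a fixed [D i], then the [D i] against
    the whole union of the [E j]. *)
Lemma cvg_mixing_average_bigcup m T K F k l (D : 'I_k -> set X)
  (E : 'I_l -> set X) :
  measure_preserving m T -> finite_measurable m F ->
  (forall i, measurable (D i) /\ D i `<=` F) ->
  (forall j, measurable (E j) /\ E j `<=` F) ->
  (forall i j, i != j -> m (D i `&` D j) = 0%E) ->
  (forall i j, i != j -> m (E i `&` E j) = 0%E) ->
  (forall i j,
     mixing_average m T F (D i) (E j) n @[n --> within K \oo] --> (0 : R)) ->
  mixing_average m T F (\bigcup_i D i) (\bigcup_j E j) n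
    @[n --> within K \oo] --> (0 : R).
Proof.
move=> mpT fF DF EF D0 E0 DE.
have cvgD0 (f g : nat -> R) : f n @[n --> within K \oo] --> (0 : R) ->
    g n @[n --> within K \oo] --> (0 : R) ->
    f n + g n @[n --> within K \oo] --> (0 : R).
  by move=> f0 g0; rewrite -[0 in X in _ --> X]addr0; exact: cvgD.
pose P B A := [/\ measurable A, A `<=` F &
  mixing_average m T F A B n @[n --> within K \oo] --> (0 : R)].
pose Q A B := [/\ measurable B, B `<=` F &
  mixing_average m T F A B n @[n --> within K \oo] --> (0 : R)].
have QE i : Q (D i) (\bigcup_j E j).
  apply: (@ae_disjoint_bigcup_ind m) => //.
  - split=> //; under eq_fun do rewrite mixing_average_set0r.
    exact: cvg_cst.
  - move=> A B [mA AF hA] [mB BF hB] AB0; split.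
    + exact: measurableU.
    + by rewrite subUset.
    + apply: (cvg0_mixing_average_le _ (cvgD0 _ _ hA hB)) => n.
      by have [mDi DiF] := DF i; exact: mixing_average_setUr.
  - by move=> j; have [] := EF j.
  - by move=> j; have [mEj EjF] := EF j.
have [mE EF'] : measurable (\bigcup_j E j) /\ \bigcup_j E j `<=` F.
  split; last by move=> x [j _]; apply: (EF j).2.
  by apply: fin_bigcup_measurable => // j _; have [] := EF j.
suff [] : P (\bigcup_j E j) (\bigcup_i D i) by [].
apply: (@ae_disjoint_bigcup_ind m) => //.
- split=> //; under eq_fun do rewrite mixing_average_set0l.
  exact: cvg_cst.
- move=> A B [mA AF hA] [mB BF hB] AB0; split.
  + exact: measurableU.
  + by rewrite subUset.
  + apply: (cvg0_mixing_average_le _ (cvgD0 _ _ hA hB)) => n.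
    exact: mixing_average_setUl.
- by move=> i; have [] := DF i.
- by move=> i; have [mDi DiF] := DF i; have [_ _ ?] := QE i.
Qed.

(** Density argument: convergence on [P] extends to its closure because the perturbation error has a
    limit that can be made arbitrarily small. *)
Lemma cvg_mixing_average_approximable m T K F (P : set (set X)) A B :
  measure_preserving m T -> finite_measurable m F ->
  weakly_rationally_ergodic_set m T K F ->
  (forall U, P U -> measurable U /\ U `<=` F) ->
  (forall U V, P U -> P V ->
     mixing_average m T F U V n @[n --> within K \oo] --> (0 : R)) ->
  measurable A -> A `<=` F -> approximable m P A ->
  measurable B -> B `<=` F -> approximable m P B ->
  mixing_average m T F A B n @[n --> within K \oo] --> (0 : R).
Proof.
move=> mpT fF wre PF PP mA AF aA mB BF aB.
have mF : measurable F by case: fF.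
apply: near_lt_cvg0 => [n|e e0]; first exact: mixing_average_ge0.
have F0 := mr_ge0 m F.
(* The limit of the bound [f] below is [c + c] with [c <= 2 * r * mr m F], which this [r] keeps
   below [e]; the added [1] keeps the denominator positive. *)
pose r := e / (4 * (mr m F + 1)).
have r0 : 0 < r by rewrite divr_gt0// mulr_gt0//; lra.
have [[U PU AU] [V PV BV]] := (aA _ r0, aB _ r0).
have [[mU UF] [mV VF]] := (PF _ PU, PF _ PV).
have mAU := measurable_setY mA mU; have mBV := measurable_setY mB mV.
have AUF := setY_sub AF UF; have BVF := setY_sub BF VF.
have fine_r D : measurable D -> D `<=` F -> (m D < r%:E)%E -> mr m D < r.
  move=> mD DF Dr; rewrite -lte_fin fineK//.
  exact/finite_measurable_fin_num/(finite_measurable_sub fF).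
have hA := fine_r _ mAU AUF AU; have hB := fine_r _ mBV BVF BV.
pose c := mr m (A `+` U) * mr m F + mr m F * mr m (B `+` V).
pose f n := mixing_average m T F U V n + (ergodic_average m T F (A `+` U) F n +
  ergodic_average m T F F (B `+` V) n) + c.
(* The first [c] is the limit of the two ergodic averages, by weak rational ergodicity of [F]; the
   second is the constant term of [f]. *)
have cvgf : f n @[n --> within K \oo] --> 0 + c + c.
  apply: cvgD; last exact: cvg_cst.
  by apply: cvgD; [exact: PP|apply: cvgD; exact: wre].
have re : r * (mr m F + 1) * 4 = e.
  by rewrite /r; field; rewrite gt_eqF//; lra.
have lime : 0 + c + c < e.
  have := mr_ge0 m (A `+` U); have := mr_ge0 m (B `+` V); rewrite /c; nra.
apply: filterS (cvgr_lt _ cvgf _ lime) => n.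
by apply: le_lt_trans; exact: mixing_average_le.
Qed.

End mixing.

(** * Borel sets of a metric space *)

Lemma closed_Gdelta_metric (R : realType) (X : topologicalType)
  (d : X -> X -> R) (F : set X) :
  is_metric d -> induces_topology d -> closed F ->
  exists V : nat -> set X, [/\ forall n, open (V n),
    {homo V : n k / (n <= k)%N >-> (k <= n)%O} & F = \bigcap_n V n].
Proof.
move=> [dxx _ dC dtri] dtop clF.
(* Open neighbourhoods of [F] of radius [1/(n+1)]; a point in all of them is adherent to [F], hence
   in [F]. *)
exists (fun n => [set x | exists2 y, F y & d y x < n.+1%:R^-1]); split.
- move=> n; rewrite openE => x [y Fy yx]; apply/dtop.
  exists (n.+1%:R^-1 - d y x); first by rewrite subr_gt0.
  move=> z /= xz; exists y => //.
  by apply: le_lt_trans (dtri _ x _) _; rewrite -ltrBrDl.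
- move=> n k nk; apply/subsetPset => x [y Fy yx]; exists y => //.
  by apply: lt_le_trans yx _; rewrite lef_pV2 ?posrE// ler_nat ltnS.
- apply/seteqP; split=> [x Fx n _|x Hx]; first by exists x; rewrite ?dxx.
  apply: clF => N /dtop[e e0 eN].
  have [n _ /(_ _ (leqnn n)) ne] := near_infty_natSinv_lt (PosNum e0).
  have [y Fy yx] := Hx n I; exists y; split=> //.
  by apply: eN => /=; rewrite dC; exact: lt_trans yx ne.
Qed.

(** Members of [P] are open, so their complements are closed and hence decreasing intersections of
    approximable open sets. This supplies the complement condition for the sigma-algebra of
    approximable sets. *)
Lemma approximable_borel (R : realType) (X : ptopologicalType)
  (nu : {measure set (borel X) -> \bar R}) (P : set (set X))
  (d : X -> X -> R) (A : set (borel X)) :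
  (nu setT < +oo)%E -> is_metric d -> induces_topology d ->
  P `<=` open -> P set0 -> (forall U V, P U -> P V -> P (U `|` V)) ->
  (forall V, open V -> approximable nu P V) ->
  measurable A -> approximable nu P A.
Proof.
move=> finnu dm dtop Po P0 PU aV mA.
have om (V : set X) : open V -> measurable (V : set (borel X)).
  exact: sub_sigma_algebra.
have Pm : P `<=` (measurable : set (set (borel X))) by move=> U /Po /om.
have PC U : P U -> approximable nu P (~` U).
  move=> PUU; have [V [oV niV ->]] :=
    closed_Gdelta_metric dm dtop (open_closedC (Po _ PUU)).
  by apply: approximable_bigcap => // n; [exact: om|exact: aV].
have := smallest_sub (sigma_algebra_approximable finnu Pm P0 PU PC).
by move=> /(_ open)/(_ (fun V oV => conj (om _ oV) (aV _ oV)))/(_ _ mA)[].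
Qed.

(** * Approximation inside [Omega] and conclusion *)

Theorem lemmaB (R : realType) (X : ptopologicalType)
  (m : {sigma_finite_measure set (borel X) -> \bar R})
  (T : borel X -> borel X) (K : set nat)
  (Omega : set X) (C : set (set X)) :
  infinite_set K ->
  polish R X ->
  m setT = +oo%E ->
  nonatomic m ->
  measure_preserving m T ->
  invertible T ->
  weakly_rationally_ergodic m T K ->
  open Omega ->
  positive_part m (R_ m T K) Omega ->
  countable C ->
  base_of_subspace Omega C ->
  (forall (k : nat) (C_ : 'I_k -> set X), (forall i, C (C_ i)) ->
     exists (l : nat) (D_ : 'I_l -> set X),
       [/\ forall j, C (D_ j),
           forall i j, i != j -> m (D_ i `&` D_ j) = 0%E &
           eq_mod_null m (\bigcup_i C_ i) (\bigcup_j D_ j)]) ->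
  (forall A B, C A -> C B ->
     mixing_average m T Omega A B n @[n --> within K \oo] --> (0 : R)) ->
  rationally_weakly_mixing m T K.
Proof.
move=> _ [_ [d [dm dtop _]]] _ _ mpT _ [consT ergT _] oOm [[fOm wOm] Om0] cC
  [Copen Cbase] CD Cmix.
have {}wOm : weakly_rationally_ergodic_set m T K Omega.
  by case: wOm Om0 => // ->; rewrite ltxx.
have om (V : set X) : open V -> measurable (V : set (borel X)).
  exact: sub_sigma_algebra.
have mOm := om _ oOm.
have Co U : C U -> open U.
  by move=> /Copen[V oV ->]; exact: openI.
have COm U : C U -> U `<=` Omega.
  by move=> /Copen[V oV ->]; exact: subIsetr.
split=> //; exists Omega => // A B mA AOm mB BOm.
(* Restricting [m] to [Omega] gives a finite measure on all Borel sets of [X], as the approximation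
   lemmas require. *)
pose nu : {measure set (borel X) -> \bar R} := mrestr m mOm.
have nuE (E : set (borel X)) : nu E = m (E `&` Omega) by [].
have finnu : (nu setT < +oo)%E by rewrite nuE setTI; case: fOm.
pose P : set (set X) := [set U | exists2 s : seq (set X),
  (forall E, E \in s -> C E) & U = \bigcup_(E in [set` s]) E].
have PC U : C U -> P U.
  move=> CU; exists [:: U]; first by move=> E; rewrite inE => /eqP ->.
  by rewrite bigcup_seq big_seq1.
have P0 : P set0.
  by exists [::] => //; rewrite bigcup_seq big_nil.
have PU U V : P U -> P V -> P (U `|` V).
  move=> [s sC ->] [t tC ->]; exists (s ++ t).
    by move=> E; rewrite mem_cat => /orP[/sC|/tC].
  by rewrite !bigcup_seq big_cat.
have Po : P `<=` open.
  by move=> _ [s sC ->]; apply: bigcup_open => E /sC/Co.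
have aP E : P E -> approximable nu P E.
  by move=> PE e e0; exists E => //; rewrite setYK measure0 lte_fin.
have Pm : P `<=` (measurable : set (set (borel X))) by move=> U /Po /om.
have aV (V : set X) : open V -> approximable nu P V.
  move=> oV; apply: approximable_trans => //; first exact: om.
  (* [V] and its trace on [Omega] differ by a [nu]-null set, and the trace is a countable union of
     elements of [C]. *)
  move=> e e0; exists (V `&` Omega); split; first by apply: om; exact: openI.
    have [D DC ->] := Cbase _ (ex_intro2 _ _ V oV erefl).
    have /pfcard_geP[->|[f]] : countable D.
        exact: sub_countable (subset_card_le DC) cC.
      by rewrite bigcup_set0; exact: aP.
    have -> : \bigcup_(W in D) W = \bigcup_n f n.
      apply/seteqP; split=> [x [W /(@surj _ _ _ _ f)[n _ <-]] Wx|x [n _ fnx]].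
        by exists n.
      by exists (f n) => //; exact: (@funS _ _ _ _ f).
    have Pf n : P (f n) by apply/PC/DC; exact: (@funS _ _ _ _ f).
    by apply: approximable_bigcup => // n; [exact: Pm|exact: aP].
  by rewrite setYD nuE setDE -setIA setICl setI0 measure0 lte_fin.
(* [Q] is not visibly closed under unions. Hence sets are approximated first by [P], for which this
   closure is immediate, and condition (a) then leads from [P] to [Q]. *)
pose Q : set (set X) := [set U | exists (l : nat) (D_ : 'I_l -> set X),
  [/\ forall j, C (D_ j), forall i j, i != j -> m (D_ i `&` D_ j) = 0%E &
      U = \bigcup_j D_ j]].
have Qo : Q `<=` open.
  by move=> _ [l [D_ [DC _ ->]]]; apply: bigcup_open => j _; exact: Co.
have Qm : Q `<=` (measurable : set (set (borel X))) by move=> U /Qo /om.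
have QOm U : Q U -> U `<=` Omega.
  by move=> [l [D_ [DC _ ->]]] x [j _]; exact: (COm _ (DC j)).
have POm U : P U -> U `<=` Omega.
  by move=> [s sC ->] x [E /sC CE]; exact: (COm _ CE).
have aQ (E : set (borel X)) :
    measurable E -> E `<=` Omega -> approximable m Q E.
  move=> mE EOm.
  have anu := approximable_borel finnu dm dtop Po P0 PU aV mE.
  apply: approximable_trans => // e e0.
  have [U PUU EU] := anu _ e0.
  exists U; split; [exact: Pm| |]; last first.
    (* Both sets lie in [Omega], where [nu] and [m] agree. *)
    rewrite nuE in EU.
    by rewrite (setIidl (setY_sub EOm (POm _ PUU))) in EU.
  move: PUU => [s sC ->] e' e'0.
  (* Condition (a), applied to the list [s] indexed by position, yields a member of [Q] at distance
     zero. *)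
  have [l [D_ [DC D0 UD]]] := CD (size s) (fun i => nth set0 s i)
    (fun i => sC _ (mem_nth _ (ltn_ord i))).
  exists (\bigcup_j D_ j); first by exists l, D_.
  have -> : \bigcup_(E in [set` s]) E = \bigcup_(i : 'I_(size s)) nth set0 s i.
    apply/seteqP; split=> [x [W /(nthP set0)[i si <-]] Wx|x [i _ ix]].
      by exists (Ordinal si).
    by exists (nth set0 s i) => //; exact: mem_nth.
  by rewrite UD lte_fin.
apply: (@cvg_mixing_average_approximable _ _ _ m T K Omega Q) => //.
- by move=> U QU; split; [exact: Qm|exact: QOm].
- move=> _ _ [k [D_ [DC D0 ->]]] [l [E_ [EC E0 ->]]].
  apply: cvg_mixing_average_bigcup => //.
  + by move=> i; split; [exact: om (Co _ (DC i))|exact: COm (DC i)].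
  + by move=> j; split; [exact: om (Co _ (EC j))|exact: COm (EC j)].
  + by move=> i j; exact: Cmix.
- exact: aQ.
- exact: aQ.
Qed.
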